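(* For all $n\geq1$, the sum of the first $8n-3$ nonzero Pell numbers is a perfect square, namely $$\sum_{i=1}^{8n-3}P_{i}=\left(\frac{20B_{n+1}^{neobc}+2B_{n}^{neobc}-7C_{n+1}^{neobc}-2R_{n}^{neobc}-19}{6}\right)^{2}.$$
   Context: Pell numbers: $P_0=0$, $P_1=1$, $P_k=2P_{k-1}+P_{k-2}$. A positive integer $m$ is a neo balcobalancing number if there is a positive integer $r$ (its neo balcobalancer) such that $(1+2+\cdots+(m-1))+(1+2+\cdots+m)=2[(m-1)+m+(m+1)+(m+2)+\cdots+(m+r)]$; then $r=\frac{-2m-1+\sqrt{8m^2-12m+9}}{2}$ (equivalently, $m$ is a neo balcobalancing number iff $8m^2-12m+9$ is a perfect square). $B_n^{neobc}$ denotes the $n$-th neo balcobalancing number in increasing order ($n\ge1$), $R_n^{neobc}$ its neo balcobalancer and $C_n^{neobc}=\sqrt{8(B_n^{neobc})^2-12B_n^{neobc}+9}$. *)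

(* Defs.v *)
From mathcomp Require Import all_boot all_order all_algebra.
From mathcomp Require Import zify.

Set Implicit Arguments.
Unset Strict Implicit.
Unset Printing Implicit Defensive.

Import GRing.Theory Num.Theory.

Fixpoint pell (k : nat) : nat :=
  match k with
  | 0 => 0
  | 1 => 1
  | (k'.+1 as k1).+1 => 2 * pell k1 + pell k'
  end.

Definition is_neo_balcobalancer (m r : nat) : bool :=
  [&& 0 < m, 0 < r &
      \sum_(1 <= i < m) i + \sum_(1 <= i < m.+1) i
        == 2 * \sum_(m.-1 <= i < (m + r).+1) i].

Definition neo_balcobalancing (m : nat) : Prop :=
  exists r, is_neo_balcobalancer m r.

Lemma is_neo_balcobalancerE m r :
  is_neo_balcobalancer m r =
  [&& 0 < m, 0 < r & m ^ 2 == (r + 2) * (2 * m + r - 1)].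
Proof.
case: m => [//|m]; rewrite /is_neo_balcobalancer /=; congr (_ && _).
have S k : (\sum_(1 <= i < k.+1) i) * 2 = k * k.+1.
  elim: k => [|k IH]; first by rewrite big_geq.
  by rewrite big_nat_recr //= mulnDl IH; lia.
have T s : (\sum_(m <= i < m + s) i) * 2 + s = s * (2 * m + s).
  elim: s => [|s IH]; first by rewrite [m + 0]addn0 big_geq.
  rewrite [m + s.+1]addnS big_nat_recr /=; last by lia.
  by rewrite mulnDl; lia.
have := T r.+2; have := S m; have := S m.+1.
have -> : m + r.+2 = (m.+1 + r).+1 by lia.
set X := \sum_(m <= i < _) i; set Y := \sum_(1 <= i < m.+1) i.
set Z := \sum_(1 <= i < m.+2) i => HZ HY HX.
have -> : 2 * m.+1 + r - 1 = 2 * m + r + 1 by lia.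
move: HX; have -> : 2 * m + r.+2 = (2 * m + r + 1).+1 by lia.
rewrite mulnS -addn2 => HX.
by apply/eqP/eqP; lia.
Qed.

Lemma neo_balcobalancer_bound m r : is_neo_balcobalancer m r -> r < (m ^ 2).+1.
Proof.
rewrite is_neo_balcobalancerE => /and3P[m0 r0 /eqP ->].
have : (r + 2) * 1 <= (r + 2) * (2 * m + r - 1) by apply: leq_mul => //; lia.
by lia.
Qed.

Lemma neo_balcobalancing_dec m : decidable (neo_balcobalancing m).
Proof.
apply: (@decP _ [exists r : 'I_(m ^ 2).+1, is_neo_balcobalancer m r]).
apply: (iffP existsP) => [[r Hr]|[r Hr]]; first by exists r.
by exists (Ordinal (neo_balcobalancer_bound Hr)).
Qed.

Lemma neo_balcobalancing_unbounded k :
  exists m, (k < m) && neo_balcobalancing_dec m.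
Proof.
elim: k => [|k [m /andP[km /sumboolP[r]]]].
  by exists 6; apply/sumboolP; exists 1; rewrite is_neo_balcobalancerE.
rewrite is_neo_balcobalancerE => /and3P[m0 r0 /eqP E].
exists (29 * m + 12 * r - 6); apply/andP; split; first by lia.
apply/sumboolP; exists (12 * m + 5 * r - 4); rewrite is_neo_balcobalancerE.
apply/and3P; split; [by lia | by lia |].
case: m m0 E {km} => // m _ E; case: r r0 E => // r _.
have -> : 29 * m.+1 + 12 * r.+1 - 6 = 29 * m + 12 * r + 35 by lia.
have -> : 12 * m.+1 + 5 * r.+1 - 4 = 12 * m + 5 * r + 13 by lia.
have -> : 2 * m.+1 + r.+1 - 1 = 2 * m + r + 2 by lia.
have -> : 2 * (29 * m + 12 * r + 35) + (12 * m + 5 * r + 13) - 1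
          = 70 * m + 29 * r + 82 by lia.
by move=> E; apply/eqP; lia.
Qed.

Definition next_neo_balcobalancing (k : nat) : nat :=
  ex_minn (neo_balcobalancing_unbounded k).

(* [Bneobc n] is the n-th neo balcobalancing number in increasing order for
   n >= 1; [Bneobc 0 = 0] is only a seed. *)
Definition Bneobc (n : nat) : nat := iter n next_neo_balcobalancing 0.

Lemma Bneobc_ex n : exists r, is_neo_balcobalancer (Bneobc n.+1) r.
Proof.
rewrite /Bneobc iterS /next_neo_balcobalancing.
by case: ex_minnP => m /andP[_ /sumboolP].
Qed.

(* The balcobalancer of a given m is unique, so the minimum only selects it;
   the value at n = 0 is junk. *)
Definition Rneobc (n : nat) : nat :=
  if n is n'.+1 then ex_minn (Bneobc_ex n') else 0.

Lemma is_neo_balcobalancer_uniq m r s :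
  is_neo_balcobalancer m r -> is_neo_balcobalancer m s -> r = s.
Proof.
rewrite !is_neo_balcobalancerE => /and3P[m0 r0 /eqP Er] /and3P[_ s0 /eqP Es].
have aux a b : a < b -> (a + 2) * (2 * m + a - 1) < (b + 2) * (2 * m + b - 1).
  by move=> ab; apply: ltn_mul; lia.
by case: (ltngtP r s) => // /aux; rewrite -Er -Es ltnn.
Qed.

Lemma Bneobc_incr n : Bneobc n < Bneobc n.+1.
Proof.
rewrite {2}/Bneobc iterS /next_neo_balcobalancing.
by case: ex_minnP => m /andP[].
Qed.

Lemma Bneobc_surj m :
  neo_balcobalancing m -> exists2 n, 0 < n & Bneobc n = m.
Proof.
move=> Hm; have m0 : 0 < m by case: Hm => r /and3P[].
have [n] : exists n, Bneobc n < m <= Bneobc n.+1.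
  have le k : k <= Bneobc k.
    by elim: k => // k IH; exact: leq_ltn_trans IH (Bneobc_incr k).
  have aux k : m <= Bneobc k -> exists n, Bneobc n < m <= Bneobc n.+1.
    elim: k => [|k IH] Hk; first by move: Hk; rewrite leqNgt m0.
    by case: (leqP m (Bneobc k)) => H; [exact: IH | exists k; rewrite H].
  exact: aux (le m).
case/andP=> Hn Hn1; exists n.+1 => //; apply/eqP; rewrite eqn_leq Hn1 andbT.
rewrite {1}/Bneobc iterS /next_neo_balcobalancing.
case: ex_minnP => p _; apply; rewrite Hn /=; exact/sumboolP.
Qed.

Local Open Scope ring_scope.

Definition Cneobc (K : rcfType) (n : nat) : K :=
  Num.sqrt (8 * (Bneobc n)%:R ^+ 2 - 12 * (Bneobc n)%:R + 9).

(* Main.v *)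
Require Import Defs.
From mathcomp Require Import all_boot all_order all_algebra.
From mathcomp Require Import zify lra.

Import GRing.Theory Num.Theory.

(** Put [y := (4 B_n - 3) / 3] and [d := C_n / 3]; then [y ^ 2 - 2 d ^ 2 = -1].
    Multiplication by [17 + 12 sqrt 2] acts on these solutions as the affine map
    [(m, r) |-> (29 m + 12 r - 6, 12 m + 5 r - 4)] on pairs (number, balancer).
    A descent along its inverse shows that [(B_n, R_n)], [n >= 1], is the
    forward orbit of the degenerate pair [(0, 1)].  The base of the square in the theorem is then
    [y], and [2 y ^ 2 + 1 = P_(8n-3) + P_(8n-2)] follows along the orbit. *)

(* Unlike [is_neo_balcobalancer], this admits [m = 0], with [r = 1]. *)
Definition neo_pair (m r : nat) : Prop :=
  0 < r /\ m ^ 2 = (r + 2) * (2 * m + r - 1).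

Lemma neo_balcobalancer_pair m r :
  is_neo_balcobalancer m r <-> 0 < m /\ neo_pair m r.
Proof.
rewrite is_neo_balcobalancerE; split; first by case/and3P=> ? ? /eqP.
by case=> ? [? ?]; apply/and3P; split=> //; apply/eqP.
Qed.

Lemma neo_pairS m r :
  neo_pair m r.+1 <-> m ^ 2 = (r + 3) * (2 * m + r).
Proof.
rewrite /neo_pair; have -> : 2 * m + r.+1 - 1 = 2 * m + r by lia.
by rewrite addSnnS; split=> [[]|].
Qed.

(** The pair equation is quadratic in [r], with discriminant [8 m ^ 2 - 12 m + 9]; its root
    evaluates [Cneobc] later. *)
Lemma neo_pair_disc m r :
  neo_pair m r -> (2 * m + 2 * r + 1) ^ 2 + 12 * m = 8 * m ^ 2 + 9.
Proof. by case: r => [[]//|r] /neo_pairS E; lia. Qed.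

Lemma neo_pair_succ m r :
  neo_pair m r -> neo_pair (29 * m + 12 * r - 6) (12 * m + 5 * r - 4).
Proof.
case: r => [[]//|r] /neo_pairS E.
have -> : 29 * m + 12 * r.+1 - 6 = 29 * m + 12 * r + 6 by lia.
have -> : 12 * m + 5 * r.+1 - 4 = (12 * m + 5 * r).+1 by lia.
by apply/neo_pairS; lia.
Qed.

(** In the form [m (m - 2 (r + 2)) = (r + 2) (r - 1)], the left side grows with [m] and shrinks with
    [r], while the right side grows with [r]. *)
Lemma neo_pair_leq p t m r :
  neo_pair p t -> neo_pair m r -> p <= m -> t <= r.
Proof.
case: t => [[]//|t] /neo_pairS Et; case: r => [[]//|r] /neo_pairS Er pm.
rewrite leqNgt; apply/negP => rt.
have Et' : p * (p - 2 * (t + 3)) = (t + 3) * t by rewrite mulnBr; lia.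
have Er' : m * (m - 2 * (r + 3)) = (r + 3) * r by rewrite mulnBr; lia.
have h : p * (p - 2 * (t + 3)) <= m * (m - 2 * (r + 3)) by apply: leq_mul; lia.
have : (r + 3) * r < (t + 3) * t by apply: ltn_mul; lia.
by lia.
Qed.

(** The linear part of the map has determinant 1, so the inverse is integral; the work is to keep
    the number nonnegative ([hp]) and the balancer positive ([ht]). *)
Lemma neo_pair_pred q s : 0 < q -> neo_pair q s ->
  exists p t, [/\ neo_pair p t, q + 6 = 29 * p + 12 * t
                & s + 4 = 12 * p + 5 * t].
Proof.
move=> q0 qs; have D := neo_pair_disc _ _ qs; have [s0 E] := qs.
have q6 : 6 <= q.
  rewrite -(leq_pmul2r q0); have -> : q * q = q ^ 2 by lia.
  rewrite E; have -> : 6 * q = 3 * (2 * q) by lia.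
  by apply: leq_mul; lia.
(* Otherwise [c = 2 q + 2 s + 1] satisfies [6 c >= 17 q - 11], against [c ^ 2 = 8 q ^ 2 - 12 q + 9]
   when [q >= 6]. *)
have hp : 12 * s + 18 <= 5 * q.
  rewrite leqNgt; apply/negP => H.
  have : (17 * q - 11) * (17 * q - 11)
         <= (6 * (2 * q + 2 * s + 1)) * (6 * (2 * q + 2 * s + 1)).
    by apply: leq_mul; lia.
  have [u {H E qs q0 q6}qE] : exists u, q = 6 + u by exists (q - 6); lia.
  have -> : 17 * q - 11 = 17 * u + 91 by lia.
  by move: D; rewrite qE; lia.
(* The discriminant root of the predecessor is positive, which forces its
   balancer to be positive. *)
have hc : 48 * q < 17 * (2 * q + 2 * s + 1) + 36.
  rewrite ltnNge; apply/negP => H.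
  have : (17 * (2 * q + 2 * s + 1)) * (17 * (2 * q + 2 * s + 1))
         <= (48 * q - 36) * (48 * q - 36) by apply: leq_mul; lia.
  have [u {H E qs q0 q6 hp}qE] : exists u, q = 6 + u by exists (q - 6); lia.
  have -> : 48 * q - 36 = 48 * u + 252 by lia.
  by move: D; rewrite qE; lia.
have ht : 12 * q < 29 * s + 44.
  rewrite ltnNge; apply/negP => H.
  (* For the predecessor [(p, t)], [a = - t] and [b = p + t], natural by [H] and [hc]. The pair
     equation at [(a + b, - a)] has no natural solution. *)
  have [a [b [qE sE]]] : exists a b, q + 6 = 17 * a + 29 * b /\
                                     s + 4 = 7 * a + 12 * b.
    by exists (12 * q - (29 * s + 44)), (17 * s + 26 - 7 * q); lia.
  have {}E : q ^ 2 + s + 2 = (s + 2) * (2 * q + s) by rewrite E mulnBr; lia.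
  have {E qE sE} : 2 * (a * a) + 4 * (a * b) + b * b + 2 = 3 * a + 4 * b.
    case: b qE sE => [|b] qE sE.
      case: a qE sE => [|a] qE sE; first by lia.
      have qE' : q = 17 * a + 11 by lia.
      have sE' : s = 7 * a + 3 by lia.
      by move: E; rewrite qE' sE'; lia.
    have qE' : q = 17 * a + 29 * b + 23 by lia.
    have sE' : s = 7 * a + 12 * b + 8 by lia.
    by move: E; rewrite qE' sE'; lia.
  case: a => [|a]; last by lia.
  by case: b => [|[|[|[|b]]]]; lia.
exists (5 * q - (12 * s + 18)), (29 * s + 44 - 12 * q).
split; [| by lia | by lia].
have [p pE] : exists p, p = 5 * q - (12 * s + 18) by eexists.
have [t tE] : exists t, t.+1 = 29 * s + 44 - 12 * q.
  by exists (29 * s + 43 - 12 * q); lia.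
rewrite -pE -tE; apply/neo_pairS.
have qE : q = 29 * p + 12 * t + 6 by lia.
have sE : s = (12 * p + 5 * t).+1 by lia.
by move: qs; rewrite qE sE => /neo_pairS; lia.
Qed.

(** Minimality of the image of [(m, r)], in a form that induction along the orbit can carry. *)
Definition neo_gap (m r : nat) : Prop :=
  forall q s, neo_pair q s -> m < q -> 29 * m + 12 * r <= q + 6.

Lemma next_neo_balcobalancing_pair m r : neo_pair m r -> neo_gap m r ->
  next_neo_balcobalancing m = 29 * m + 12 * r - 6.
Proof.
move=> mr gap; have S := neo_pair_succ _ _ mr; have r0 : 0 < r by case: mr.
rewrite /next_neo_balcobalancing.
case: ex_minnP => q /andP[mq /sumboolP[s /neo_balcobalancer_pair[_ qs]]] minq.
apply/eqP; rewrite eqn_leq; apply/andP; split; last first.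
  by have := gap _ _ qs mq; lia.
apply: minq; apply/andP; split; first by lia.
apply/sumboolP; exists (12 * m + 5 * r - 4).
by apply/neo_balcobalancer_pair; split=> //; lia.
Qed.

(** A solution beyond the image has its predecessor beyond [m], hence not below the image by the gap
    at [m]; applying the monotone map once more concludes. *)
Lemma neo_gap_succ m r : neo_pair m r -> neo_gap m r ->
  neo_gap (29 * m + 12 * r - 6) (12 * m + 5 * r - 4).
Proof.
move=> mr gap q s qs mq; have S := neo_pair_succ _ _ mr.
have r0 : 0 < r by case: mr.
have [|p [t [pt qE sE]]] := neo_pair_pred q s _ qs; first by lia.
have mp : m < p.
  rewrite ltnNge; apply/negP => pm.
  by have := neo_pair_leq _ _ _ _ pt mr pm; lia.
have Mp := gap _ _ pt mp.
have : 12 * m + 5 * r - 4 <= t by apply: neo_pair_leq S pt _; lia.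
by lia.
Qed.

Lemma neo_gap0 : neo_gap 0 1.
Proof.
move=> q s qs q0; have [p [t [[t0 _] qE _]]] := neo_pair_pred q s q0 qs.
by lia.
Qed.

Lemma Bneobc_pair_gap n :
  exists r, neo_pair (Bneobc n) r /\ neo_gap (Bneobc n) r.
Proof.
elim: n => [|n [r [mr gap]]]; first by exists 1; split; [|exact: neo_gap0].
exists (12 * Bneobc n + 5 * r - 4).
rewrite /Bneobc iterS -/(Bneobc n) (next_neo_balcobalancing_pair _ _ mr gap).
by split; [exact: neo_pair_succ | exact: neo_gap_succ].
Qed.

Lemma neo_pair_inj m r s : neo_pair m r -> neo_pair m s -> r = s.
Proof.
move=> mr ms; apply/eqP; rewrite eqn_leq.
by rewrite (neo_pair_leq _ _ _ _ mr ms) ?(neo_pair_leq _ _ _ _ ms mr).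
Qed.

Lemma Rneobc_pair n : neo_pair (Bneobc n.+1) (Rneobc n.+1).
Proof.
by rewrite /Rneobc; case: ex_minnP => r /neo_balcobalancer_pair[].
Qed.

Lemma Bneobc1 : Bneobc 1 = 6.
Proof. by rewrite /Bneobc /= (next_neo_balcobalancing_pair 0 1 _ neo_gap0). Qed.

Lemma Rneobc1 : Rneobc 1 = 1.
Proof.
by apply: (neo_pair_inj 6); first by rewrite -Bneobc1; exact: Rneobc_pair.
Qed.

Lemma BneobcS n : Bneobc n.+2 = 29 * Bneobc n.+1 + 12 * Rneobc n.+1 - 6.
Proof.
have [r [mr gap]] := Bneobc_pair_gap n.+1.
rewrite -(neo_pair_inj _ _ _ mr (Rneobc_pair n)).
exact: next_neo_balcobalancing_pair.
Qed.

Lemma RneobcS n : Rneobc n.+2 = 12 * Bneobc n.+1 + 5 * Rneobc n.+1 - 4.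
Proof.
apply: neo_pair_inj (Rneobc_pair _) _; rewrite BneobcS.
exact/neo_pair_succ/Rneobc_pair.
Qed.

Lemma Cneobc_nat (K : rcfType) n :
  Cneobc K n.+1 = (2 * Bneobc n.+1 + 2 * Rneobc n.+1 + 1)%:R%R.
Proof.
rewrite /Cneobc; have := neo_pair_disc _ _ (Rneobc_pair n).
move: (Bneobc _) (2 * _ + _ + 1) => m c /(congr1 (fun k => k%:R%R : K)).
move=> E; rewrite -[RHS]ger0_norm ?ler0n // -sqrtr_sqr; congr Num.sqrt.
by lra.
Qed.

Lemma pellS k : pell k.+2 = 2 * pell k.+1 + pell k.
Proof. by []. Qed.

Lemma sum_pell k : 2 * (\sum_(1 <= i < k.+1) pell i) + 1 = pell k + pell k.+1.
Proof.
elim: k => [|k IH]; first by rewrite big_geq.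
by rewrite big_nat_recr //= mulnDr addnAC IH; case: k {IH} => [|k] //=; lia.
Qed.

(* [y] and [d] are the half-companion Pell number and the Pell number of index
   [4 n + 3]. *)
Lemma neobc_pell n : exists y d,
  [/\ 4 * Bneobc n.+1 = 3 * y + 3,
      2 * Bneobc n.+1 + 2 * Rneobc n.+1 + 1 = 3 * d,
      y * y + 1 = 2 * (d * d),
      pell (8 * n + 6) = 2 * (y * d)
    & pell (8 * n + 5) + 2 * (y * d) = 2 * (y * y) + 1].
Proof.
elim: n => [|n [y [d [By Rd yd P6 P5]]]].
  by exists 7, 5; rewrite Bneobc1 Rneobc1.
(* Coefficients of [(17 + 12 sqrt 2) (y + d sqrt 2)]; the factor is [(1 + sqrt 2) ^ 4], so the index
   of [y] and [d] moves by 4. *)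
exists (17 * y + 24 * d), (12 * y + 17 * d); rewrite BneobcS RneobcS.
have R0 : 0 < Rneobc n.+1 by case: (Rneobc_pair n).
have -> : 8 * n.+1 + 6 = (8 * n + 5).+1.+4.+4 by lia.
have -> : 8 * n.+1 + 5 = (8 * n + 5).+4.+4 by lia.
have e6 : 8 * n + 6 = (8 * n + 5).+1 by lia.
move: P6; rewrite e6 => P6.
by rewrite !pellS; split; lia.
Qed.

Local Open Scope ring_scope.

Theorem theorem9p2 (K : rcfType) (n : nat) (hn : (1 <= n)%N) :
  (exists k : nat, (\sum_(1 <= i < (8 * n - 3).+1) pell i = k ^ 2)%N) /\
  ((\sum_(1 <= i < (8 * n - 3).+1) pell i)%N)%:R =
  ((20 * (Bneobc n.+1)%:R + 2 * (Bneobc n)%:R - 7 * Cneobc K n.+1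
    - 2 * (Rneobc n)%:R - 19) / 6) ^+ 2 :> K.
Proof.
case: n hn => // n _.
have [y [d [By Rd yd P6 P5]]] := neobc_pell n.
have sumE : (\sum_(1 <= i < (8 * n.+1 - 3).+1) pell i = y ^ 2)%N.
  have -> : (8 * n.+1 - 3 = 8 * n + 5)%N by lia.
  by have := sum_pell (8 * n + 5); rewrite -addnS P6; lia.
rewrite sumE; split; first by exists y.
(* The recurrences reduce the numerator to [8 * Bneobc n.+1 - 6], which is [6 * y]; the negative
   terms are moved across to stay in [nat]. *)
have lin : (20 * Bneobc n.+2 + 2 * Bneobc n.+1 =
  6 * y + 7 * (2 * Bneobc n.+2 + 2 * Rneobc n.+2 + 1) + 2 * Rneobc n.+1 + 19)%N.
  have R0 : (0 < Rneobc n.+1)%N by case: (Rneobc_pair n).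
  by rewrite BneobcS RneobcS; lia.
rewrite Cneobc_nat natrX; congr (_ ^+ 2).
move: lin => /(congr1 (fun k => k%:R : K)).
move: (2 * Bneobc n.+2 + _ + 1)%N => c E.
by lra.
Qed.
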